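(* Let $F>0$ be a file size and let $\pi$ be a dynamic policy. Let $|\pi|$ be the number of successful transmissions needed to transfer the file of size $F$ under $\pi$, and for $n=1,\dots,|\pi|$ let $F_n$ be the remaining file size right before the $n$-th successful transmission. Then the expected transfer time of $\pi$ is $$\mathbb E[T(\pi,F)] = \Delta\left(\sum_{n=1}^{|\pi|-1}\frac{1}{p_{\pi(F_n)}}\right)+\Delta\,\frac{1-p_{\pi(F_{|\pi|})}}{p_{\pi(F_{|\pi|})}}+\frac{F_{|\pi|}}{r_{\pi(F_{|\pi|})}}.$$
   Context: There is a finite set of channels $\mathcal N=\{1,\dots,N\}$ and a fixed slot length $\Delta>0$. Channel $i$ has rate $r_i>0$ and availability probability $p_i\in(0,1]$. For each $i\in\mathcal N$, $\{Y_i(k)\}_{k=0,1,2,\dots}$ is an i.i.d. Bernoulli sequence with $P[Y_i(k)=1]=p_i=1-P[Y_i(k)=0]$, and these sequences are independent over channels. A dynamic policy is a deterministic map $\pi$ from remaining file sizes $s\in[0,\infty)$ to $\mathcal N$: at the beginning of each slot, if the remaining file size is $s>0$, channel $\pi(s)$ is sensed. If $Y_{\pi(s)}(k)=0$ in the current slot $k$, nothing is transmitted, the slot costs time $\Delta$, and the remaining size stays $s$. If $Y_{\pi(s)}(k)=1$ (a ''successful transmission''), data is sent at rate $r_{\pi(s)}$ during the slot, the remaining size becomes $(s-\Delta r_{\pi(s)})^+=\max\{0,s-\Delta r_{\pi(s)}\}$, and the time spent is $\min\{\Delta,s/r_{\pi(s)}\}$. The process stops when the remaining size is $0$. $T(\pi,F)$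 is the total time spent starting from remaining size $F$ until remaining size $0$; equivalently, it is the first time $T$ at which the cumulative transmitted data $\int_0^T r_{\pi(t)}X_{\pi(t)}(t)\,dt$ reaches $F$, where $X_i(t)=Y_i(\lfloor t/\Delta\rfloor)$ and $\pi(t)$ denotes the channel sensed in the slot containing $t$. The remaining sizes before successive successful transmissions are deterministic: $F_1=F$ and $F_{n}=F_{n-1}-\Delta r_{\pi(F_{n-1})}$ for $2\le n\le|\pi|$, where $|\pi|\ge1$ is the first index $n$ with $F_n\le\Delta r_{\pi(F_n)}$ (so the file is completed during the $|\pi|$-th successful transmission). *)

(* Defs.v *)
From mathcomp Require Import all_boot all_order all_algebra finmap.
From mathcomp Require Import all_classical all_reals all_analysis.

Set Implicit Arguments.
Unset Strict Implicit.
Unset Printing Implicit Defensive.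

Import Order.TTheory GRing.Theory Num.Theory.

Local Open Scope classical_set_scope.
Local Open Scope ring_scope.

(* Mutual independence: the product rule over every finite subfamily. *)
Definition mutually_independent d d' (Omega : measurableType d)
    (E : measurableType d') (R : realType) (P : probability Omega R)
    (I : choiceType) (X : I -> {RV P >-> E}) : Prop :=
  forall (J : {fset I}) (A : I -> set E), (forall i, measurable (A i)) ->
    P (\bigcap_(i in [set` J]) (X i @^-1` A i)) =
    (\prod_(i <- J) P (X i @^-1` A i))%E.

(* A policy is a total map [R -> 'I_N]; the process only evaluates it at
   positive remaining sizes. *)

(* [y i k] tells whether channel [i] is available in slot [k]. *)

Fixpoint remaining_size (R : realType) (N : nat) (Delta : R) (r : 'I_N -> R)
    (pi : R -> 'I_N) (F : R) (y : 'I_N -> nat -> bool) (k : nat) : R :=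
  if k is k'.+1 then
    let s := remaining_size Delta r pi F y k' in
    if (0 < s) && y (pi s) k' then Num.max 0 (s - Delta * r (pi s)) else s
  else F.

Definition slot_time (R : realType) (N : nat) (Delta : R) (r : 'I_N -> R)
    (pi : R -> 'I_N) (F : R) (y : 'I_N -> nat -> bool) (k : nat) : R :=
  let s := remaining_size Delta r pi F y k in
  if 0 < s then
    if y (pi s) k then Num.min Delta (s / r (pi s)) else Delta
  else 0.

(* Infinite if the file is never completed. *)
Definition transfer_time (R : realType) (N : nat) (Delta : R) (r : 'I_N -> R)
    (pi : R -> 'I_N) (F : R) (y : 'I_N -> nat -> bool) : \bar R :=
  (\sum_(0 <= k <oo) (slot_time Delta r pi F y k)%:E)%E.

(* The size F_n before the n-th successful transmission, for n >= 1. It is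
   meaningful up to the index [num_transmissions] below, past which the
   recursion leaves [0, +oo[. *)
Definition success_size (R : realType) (N : nat) (Delta : R) (r : 'I_N -> R)
    (pi : R -> 'I_N) (F : R) (n : nat) : R :=
  iter n.-1 (fun s => s - Delta * r (pi s)) F.

Lemma final_transmission_exists (R : realType) (N : nat) (Delta : R)
    (r : 'I_N -> R) (Delta_gt0 : 0 < Delta) (r_gt0 : forall i, 0 < r i)
    (pi : R -> 'I_N) (F : R) :
  exists n, (0 < n)%N &&
    (success_size Delta r pi F n
     <= Delta * r (pi (success_size Delta r pi F n))).
Proof.
pose f n := success_size Delta r pi F n.
have [i0 _ i0_min] := @arg_minP _ R 'I_N (pi 0) xpredT r isT.
pose c := Delta * r i0.
have c_gt0 : 0 < c by rewrite mulr_gt0.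
have decr n : f n.+1 <= F - c *+ n.
  elim: n => [|n IHn]; first by rewrite mulr0n subr0.
  rewrite /f /success_size /= -/(success_size Delta r pi F n.+1) -/(f n.+1).
  by rewrite mulrSr opprD addrA lerB// ler_pM2l// i0_min.
exists (Num.truncn (F / c)).+2; rewrite /= -/(f _).
apply: (@le_trans _ _ 0); last by rewrite mulr_ge0// ltW.
apply: le_trans (decr _) _.
rewrite subr_le0 -mulr_natl -ler_pdivrMr//.
exact/ltW/truncnS_gt.
Qed.

(* The number |pi| of successful transmissions. *)
Definition num_transmissions (R : realType) (N : nat) (Delta : R)
    (r : 'I_N -> R) (Delta_gt0 : 0 < Delta) (r_gt0 : forall i, 0 < r i)
    (pi : R -> 'I_N) (F : R) : nat :=
  ex_minn (final_transmission_exists Delta_gt0 r_gt0 pi F).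

(* Main.v *)
(* Let c_k be the number of successful slots before slot k, counted along the
   sequence of channels pi F_1, pi F_2, ... without stopping at completion.
   Before slot k the remaining size is F_(c_k + 1) if c_k < |pi| and 0
   otherwise, so slot k costs on average
     sum_(n < |pi|) P(c_k = n) (q_n min(Delta, F_(n+1) / r) + (1 - q_n) Delta)
   with q_n = p (pi F_(n+1)), because [c_k = n] depends only on slots before k.
   Flow balance, P(c_(k+1) = n) = (1 - q_n) P(c_k = n) + q_(n-1) P(c_k = n-1),
   gives sum_k P(c_k = n) = 1 / q_n; summing the cost over k by monotone
   convergence yields the formula. *)

Require Import Defs.
From mathcomp Require Import all_boot all_order all_algebra finmap.
From mathcomp Require Import all_classical all_reals all_analysis.
From mathcomp Require Import measurable_realfun ring.

Import Order.TTheory GRing.Theory Num.Theory.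
Import numFieldNormedType.Exports.

Local Open Scope classical_set_scope.
Local Open Scope ring_scope.

(** * Flow balance along a chain of states *)

(* [u] is the occupancy of a state, [q * u] its outflow, [e k] the mass that has
   entered it by time [k]. *)
Lemma outflow_cvg {R : realType} (q : R) (e u : nat -> R) :
  0 < q -> (forall k, 0 <= u k) -> (forall k, e k <= 1) -> e @ \oo --> (1 : R) ->
  (forall k, q * series u k + u k = e k) ->
  (forall k, q * series u k <= 1) /\ (fun k => q * series u k) @ \oo --> (1 : R).
Proof.
move=> q_gt0 u_ge0 e_le1 e_cvg balance.
have q_series_le1 k : q * series u k <= 1.
  by apply: le_trans (e_le1 k); rewrite -balance lerDl.
split=> //.
(* The partial sums of [u] increase and stay below [1 / q], so [u] tends to 0 and [q * series u] has
   the same limit as [e]. *)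
have u_cvg0 : u @ \oo --> (0 : R).
  apply: cvg_series_cvg_0; apply: nondecreasing_is_cvgn.
    by apply/nondecreasing_seqP => k; rewrite seriesSr lerDl.
  exists q^-1 => _ [k _ <-].
  by rewrite -[leRHS]mul1r ler_pdivlMr// mulrC.
rewrite (_ : (fun k => _) = e - u); last first.
  by apply/funext => k; rewrite !fctE -balance addrK.
by rewrite -[X in _ --> X]subr0; exact: cvgB.
Qed.

(** Induction along the chain: what flows out of state [n] is exactly what enters state [n.+1], so
    the outflow limit 1 passes from each state to the next. *)
Lemma sojourn_series_cvg {R : realType} (q : nat -> R) (a : nat -> nat -> R) :
  (forall n, 0 < q n) -> (forall k n, 0 <= a k n) ->
  (forall n, a 0 n = (n == 0)%:R) ->
  (forall k, a k.+1 0 = a k 0 * (1 - q 0)) ->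
  (forall k n, a k.+1 n.+1 = a k n.+1 * (1 - q n.+1) + a k n * q n) ->
  forall n, series (a ^~ n) @ \oo --> (q n)^-1.
Proof.
move=> q_gt0 a_ge0 a0 aS0 aSS n.
suff [_ cvg1] : (forall k, q n * series (a ^~ n) k <= 1) /\
    (fun k => q n * series (a ^~ n) k) @ \oo --> (1 : R).
  have qn_neq0 := lt0r_neq0 (q_gt0 n).
  rewrite (_ : series _ = (fun k => (q n)^-1 * (q n * series (a ^~ n) k))).
    by rewrite -[X in _ --> X]mulr1; apply: cvgMr.
  by apply/funext => k; rewrite mulKf.
elim: n => [|n [IHle IHcvg]].
  (* State 0 holds all the mass at time 0 and receives nothing later, so the mass entered is
     constantly 1. *)
  apply: (@outflow_cvg _ _ (fun=> 1)) => //; first exact: cvg_cst.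
  elim=> [|k IHk]; first by rewrite seriesEnat/= big_geq// mulr0 a0 add0r.
  rewrite -[RHS]IHk seriesSr aS0; ring.
apply: (@outflow_cvg _ _ (fun k => q n * series (a ^~ n) k)) => //.
elim=> [|k IHk]; first by rewrite !seriesEnat/= !big_geq// !mulr0 a0 add0r.
rewrite !seriesSr aSS [RHS]mulrDr -IHk; ring.
Qed.

(** * Independence of past events from future slots *)

(* [E] is independent of the channel states in slots [k], [k.+1], ... *)
Definition independent_of_future {R : realType} {d} {Omega : measurableType d}
    {P : probability Omega R} {N : nat} (Y : 'I_N -> nat -> {RV P >-> bool})
    (k : nat) (E : set Omega) : Prop :=
  measurable E /\
  forall (J : {fset 'I_N * nat}) (A : 'I_N * nat -> set bool),
    (forall j, j \in J -> (k <= j.2)%N) ->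
    P (E `&` \bigcap_(j in [set` J]) (Y j.1 j.2 @^-1` A j)) =
    (P E * \prod_(j <- J) P (Y j.1 j.2 @^-1` A j))%E.

Section independence.
Context {R : realType} {d : measure_display} {Omega : measurableType d}.
Context {P : probability Omega R} {N : nat}.
Implicit Type Y : 'I_N -> nat -> {RV P >-> bool}.

Lemma measurable_channel Y i k (B : set bool) : measurable (Y i k @^-1` B).
Proof. exact: measurable_funPTI. Qed.

Lemma independent_of_future_setT Y :
  mutually_independent (fun ik : 'I_N * nat => Y ik.1 ik.2) ->
  independent_of_future Y 0 setT.
Proof.
move=> Y_indep; split=> // J A _.
by rewrite setTI probability_setT mul1e Y_indep.
Qed.

Lemma independent_of_future_set0 Y k : independent_of_future Y k set0.
Proof. by split=> // J A _; rewrite set0I measure0 mul0e. Qed.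

(** Slot [k] joins the past by adding [(i, k)] to the family [J], so the remaining future begins at
    [k.+1]. *)
Lemma independent_of_future_slot Y k i (B : set bool) E :
  independent_of_future Y k E ->
  independent_of_future Y k.+1 (E `&` Y i k @^-1` B) /\
  P (E `&` Y i k @^-1` B) = (P E * P (Y i k @^-1` B))%E.
Proof.
move=> [mE E_indep].
have extend (J : {fset 'I_N * nat}) (A : 'I_N * nat -> set bool) :
    (forall j, j \in J -> (k < j.2)%N) ->
    P ((E `&` Y i k @^-1` B) `&` \bigcap_(j in [set` J]) (Y j.1 j.2 @^-1` A j)) =
    (P E * P (Y i k @^-1` B) * \prod_(j <- J) P (Y j.1 j.2 @^-1` A j))%E.
  move=> J_future.
  (* Every index of [J] lies in a slot after [k], so [(i, k)] is fresh and [A'] can prescribe [B]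
     there without disturbing [A] on [J]. *)
  have ikJ : (i, k) \notin J by apply/negP => /J_future; rewrite ltnn.
  pose A' j := if j == (i, k) then B else A j.
  have A'J j : j \in J -> A' j = A j.
    by move=> jJ; rewrite /A'; case: eqP => // jE; rewrite -jE jJ in ikJ.
  have A'ik : A' (i, k) = B by rewrite /A' eqxx.
  have := E_indep ((i, k) |` J)%fset A'.
  rewrite bigcap_fsetU1 big_fsetU1//= A'ik setIA muleA => E_A'.
  rewrite (@eq_bigcapr _ _ _ _ (fun j => Y j.1 j.2 @^-1` A' j)); last first.
    by move=> j /= jJ; rewrite A'J.
  rewrite E_A'; last first.
    by move=> j /fset1UP[->//|/J_future/ltnW].
  by congr (_ * _)%E; apply: eq_big_seq => j jJ; rewrite A'J.
have PE : P (E `&` Y i k @^-1` B) = (P E * P (Y i k @^-1` B))%E.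
  (* The empty family isolates the probability of the event itself. *)
  have := extend fset0 (fun=> setT).
  by rewrite set_fset0 bigcap_set0 setIT big_seq_fset0 mule1; exact.
split=> //; split; first by apply: measurableI => //; exact: measurable_channel.
by move=> J A J_future; rewrite PE extend.
Qed.

(** Disjointness makes both sides of the product rule additive in the event. *)
Lemma independent_of_futureU Y k E1 E2 : E1 `&` E2 = set0 ->
  independent_of_future Y k E1 -> independent_of_future Y k E2 ->
  independent_of_future Y k (E1 `|` E2).
Proof.
move=> E12 [mE1 indep1] [mE2 indep2].
split=> [|J A J_future]; first exact: measurableU.
have mG : measurable (\bigcap_(j in [set` J]) (Y j.1 j.2 @^-1` A j)).
  by apply: fin_bigcap_measurable => // j _; exact: measurable_channel.
rewrite setIUl measureU//; [|exact: measurableI|exact: measurableI|].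
- rewrite [X in (X + _)%E](indep1 J A)// [X in (_ + X)%E](indep2 J A)//.
  by rewrite -ge0_muleDl// -measureU.
- by rewrite setIACA E12 set0I.
Qed.

End independence.

(** * The success count and the expected cost it generates *)

(** [i n] is the channel sensed after [n] successes. Counting never stops, so one recursion serves
    all states; the cutoff at completion is left to [staged_cost]. *)
Fixpoint success_count {N : nat} (i : nat -> 'I_N) (y : 'I_N -> nat -> bool)
    (k : nat) : nat :=
  if k is k'.+1 then
    let c := success_count i y k' in (c + y (i c) k')%N
  else 0.

(** Arbitrary costs [u] and [v] keep the computation of expectations free of file sizes; slot times
    are one instance. *)
Definition staged_cost {R : realType} {N : nat} (i : nat -> 'I_N) (m : nat)
    (u v : nat -> R) (y : 'I_N -> nat -> bool) (k : nat) : R :=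
  let c := success_count i y k in
  if (c < m)%N then if y (i c) k then u c else v c else 0.

Section success_count.
Context {R : realType} {d : measure_display} {Omega : measurableType d}.
Context {P : probability Omega R} {N : nat}.
Context (i : nat -> 'I_N) (Y : 'I_N -> nat -> {RV P >-> bool}).

Definition success_count_event (k n : nat) : set Omega :=
  [set w | success_count i (fun j l => Y j l w) k = n].

Local Notation E := success_count_event.

Lemma success_count_eventS0 k : E k.+1 0 = E k 0 `&` Y (i 0) k @^-1` [set false].
Proof.
apply/seteqP; split=> w; rewrite /E /=; last by move=> [-> ->].
by case: (success_count _ _ k) => //; case: (Y _ _ w).
Qed.

Lemma success_count_eventSS k n : E k.+1 n.+1 =
  (E k n.+1 `&` Y (i n.+1) k @^-1` [set false]) `|`
  (E k n `&` Y (i n) k @^-1` [set true]).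
Proof.
apply/seteqP; split=> w; rewrite /E /=; last first.
  by move=> [[-> ->]|[-> ->]]; rewrite ?addn0 ?addn1.
set c := success_count _ _ k; case Ycw: (Y (i c) k w).
  by rewrite addn1 => -[cn]; right; rewrite -cn.
by rewrite addn0 => cn; left; rewrite -cn.
Qed.

Lemma success_count_event_disjoint k n (B C : set Omega) :
  (E k n.+1 `&` B) `&` (E k n `&` C) = set0.
Proof.
by apply/seteqP; split=> // w [[cS _] [cn _]]; exact: n_Sn (etrans (esym cn) cS).
Qed.

Context (Y_indep : mutually_independent (fun ik : 'I_N * nat => Y ik.1 ik.2)).

(** Given the count before slot [k], the sensed channel is fixed, so each event at [k.+1] splits
    into disjoint pieces, each an event at [k] cut by one channel state in slot [k]. *)
Lemma success_count_event_independent k n : independent_of_future Y k (E k n).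
Proof.
elim: k n => [|k IHk] [|n].
- rewrite (_ : E 0 0 = setT); first exact: independent_of_future_setT.
  by apply/seteqP; split.
- rewrite (_ : E 0 n.+1 = set0); first exact: independent_of_future_set0.
  by apply/seteqP; split.
- by rewrite success_count_eventS0; have [] :=
    independent_of_future_slot Y k (i 0) [set false] _ (IHk 0).
- rewrite success_count_eventSS; apply: independent_of_futureU.
  + exact: success_count_event_disjoint.
  + by have [] := independent_of_future_slot Y k (i n.+1) [set false] _ (IHk n.+1).
  + by have [] := independent_of_future_slot Y k (i n) [set true] _ (IHk n).
Qed.

Lemma measurable_success_count_event k n (B : set bool) :
  measurable (E k n `&` Y (i n) k @^-1` B).
Proof.
apply: measurableI; last exact: measurable_channel.
by have [] := success_count_event_independent k n.
Qed.

Context (p : 'I_N -> R).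
Context (Y_bernoulli : forall j k, P [set w | Y j k w = true] = (p j)%:E).

Lemma probability_channel_unavailable j k :
  P (Y j k @^-1` [set false]) = (1 - p j)%:E.
Proof.
rewrite (_ : _ @^-1` _ = ~` (Y j k @^-1` [set true])).
  rewrite probability_setC; last exact: measurable_channel.
  by rewrite (Y_bernoulli j k).
by apply/seteqP; split=> w /=; case: (Y j k w).
Qed.

Definition success_count_pmf (k n : nat) : R := fine (P (E k n)).

Local Notation a := success_count_pmf.

Lemma probability_success_count k n : P (E k n) = (a k n)%:E.
Proof.
rewrite fineK// fin_num_measure//.
by have [] := success_count_event_independent k n.
Qed.

Lemma probability_success k n :
  P (E k n `&` Y (i n) k @^-1` [set true]) = (a k n * p (i n))%:E.
Proof.
have [_ ->] := independent_of_future_slot Y k (i n) [set true] _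
  (success_count_event_independent k n).
by rewrite (Y_bernoulli (i n) k) probability_success_count.
Qed.

Lemma probability_failure k n :
  P (E k n `&` Y (i n) k @^-1` [set false]) = (a k n * (1 - p (i n)))%:E.
Proof.
have [_ ->] := independent_of_future_slot Y k (i n) [set false] _
  (success_count_event_independent k n).
by rewrite probability_channel_unavailable probability_success_count.
Qed.

Context (p_gt0 : forall j, 0 < p j).

(** The series sums to the expected number of slots spent at count [n], the mean of a geometric
    waiting time. *)
Lemma success_count_pmf_series_cvg n :
  series (a ^~ n) @ \oo --> (p (i n))^-1.
Proof.
apply: (sojourn_series_cvg (fun n => p (i n)) a) => //.
- by move=> k n'; exact: fine_ge0.
- case=> [|n']; rewrite /a.
    rewrite (_ : E 0 0 = setT) ?probability_setT//.
    by apply/seteqP; split.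
  rewrite (_ : E 0 n'.+1 = set0) ?measure0//.
  by apply/seteqP; split.
- move=> k; apply: EFin_inj.
  by rewrite -probability_success_count success_count_eventS0 probability_failure.
- move=> k n'; apply: EFin_inj.
  rewrite -probability_success_count success_count_eventSS measureU.
  + by rewrite [X in (X + _)%E]probability_failure
       [X in (_ + X)%E]probability_success EFinD.
  + exact: measurable_success_count_event.
  + exact: measurable_success_count_event.
  + exact: success_count_event_disjoint.
Qed.

(** On each event of fixed count the random channel [i c] becomes the fixed channel [i n], so
    independence applies term by term. *)
Lemma staged_cost_indic m (u v : nat -> R) k w :
  staged_cost i m u v (fun j l => Y j l w) k =
  \sum_(n < m) (u n * \1_(E k n `&` Y (i n) k @^-1` [set true]) w +
                v n * \1_(E k n `&` Y (i n) k @^-1` [set false]) w).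
Proof.
rewrite /staged_cost; set c := success_count _ _ k.
have outside n : c != n ->
    u n * \1_(E k n `&` Y (i n) k @^-1` [set true]) w +
    v n * \1_(E k n `&` Y (i n) k @^-1` [set false]) w = 0.
  move=> /eqP cn; rewrite !indicE !memNset ?mulr0 ?addr0//.
  - by move=> [/cn].
  - by move=> [/cn].
case: ltnP => cm; last first.
  rewrite big1// => n _; apply: outside.
  by rewrite neq_ltn (leq_trans (ltn_ord n) cm) orbT.
rewrite (bigD1 (Ordinal cm))//= big1 ?addr0; last first.
  by move=> n /eqP ncm; apply: outside; apply/eqP => cn; apply/ncm/val_inj.
rewrite !indicE; case Ycw: (Y (i c) k w).
  by rewrite mem_set// memNset ?mulr1 ?mulr0 ?addr0// => -[_ /=]; rewrite Ycw.
by rewrite memNset ?mem_set// ?mulr1 ?mulr0 ?add0r// => -[_ /=]; rewrite Ycw.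
Qed.

Lemma integral_staged_cost m (u v : nat -> R) k :
  (forall n, (n < m)%N -> 0 <= u n) -> (forall n, (n < m)%N -> 0 <= v n) ->
  (\int[P]_w (staged_cost i m u v (fun j l => Y j l w) k)%:E =
   (\sum_(n < m) a k n * (u n * p (i n) + v n * (1 - p (i n))))%:E)%E.
Proof.
move=> u_ge0 v_ge0.
pose f (n : 'I_m) B (x : R) w : \bar R :=
  (x%:E * (\1_(E k n `&` Y (i n) k @^-1` B) w)%:E)%E.
have f_ge0 n B x w : 0 <= x -> (0 <= f n B x w)%E.
  by move=> x_ge0; rewrite mule_ge0// lee_fin.
have mf n B x : measurable_fun setT (f n B x).
  apply: measurable_funeM; apply/measurable_EFinP; apply: measurable_indic.
  exact: measurable_success_count_event.
have int_f n B x : 0 <= x -> (\int[P]_w f n B x w =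
    x%:E * P (E k n `&` Y (i n) k @^-1` B))%E.
  move=> x_ge0; have mEB := measurable_success_count_event k n B.
  rewrite ge0_integralZl_EFin//; last exact/measurable_EFinP/measurable_indic.
  by rewrite integral_indic// setIT.
transitivity (\int[P]_w \sum_(n < m)
    (f n [set true] (u n) w + f n [set false] (v n) w))%E.
  by apply: eq_integral => w _; rewrite staged_cost_indic -sumEFin.
rewrite ge0_integral_sum//; last 2 first.
- by move=> n; apply: emeasurable_funD.
- by move=> n w _; rewrite adde_ge0// f_ge0// (u_ge0, v_ge0).
rewrite -sumEFin; apply: eq_bigr => n _.
have [un_ge0 vn_ge0] := (u_ge0 n (ltn_ord n), v_ge0 n (ltn_ord n)).
rewrite ge0_integralD//; [|by move=> *; exact: f_ge0..].
rewrite !int_f// probability_success probability_failure -!EFinM -EFinD.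
by congr EFin; ring.
Qed.
End success_count.

(** Tonelli exchanges expectation and the sum over slots; each stage then contributes one success
    cost and [(1 - p (i n)) / p (i n)] expected failure costs. *)
Lemma integral_staged_cost_series {R : realType} {d} {Omega : measurableType d}
    {P : probability Omega R} {N : nat} (i : nat -> 'I_N)
    (Y : 'I_N -> nat -> {RV P >-> bool}) (p : 'I_N -> R) (m : nat)
    (u v : nat -> R) :
  mutually_independent (fun ik : 'I_N * nat => Y ik.1 ik.2) ->
  (forall j k, P [set w | Y j k w = true] = (p j)%:E) ->
  (forall j, 0 < p j) ->
  (forall n, (n < m)%N -> 0 <= u n) -> (forall n, (n < m)%N -> 0 <= v n) ->
  (\int[P]_w \sum_(0 <= k <oo) (staged_cost i m u v (fun j l => Y j l w) k)%:E =
   (\sum_(n < m) (u n + v n * ((1 - p (i n)) / p (i n))))%:E)%E.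
Proof.
move=> Y_indep Y_bernoulli p_gt0 u_ge0 v_ge0.
rewrite integral_nneseries//; last 2 first.
- move=> k; apply/measurable_EFinP.
  rewrite (funext (fun w => staged_cost_indic i Y m u v k w)).
  apply: measurable_sum => n.
  apply: measurable_funD; apply: measurable_funM => //;
  by apply: measurable_indic; exact: measurable_success_count_event.
- move=> k w _; rewrite lee_fin /staged_cost; case: ltnP => // c_lt_m.
  by case: ifP => _; [exact: u_ge0|exact: v_ge0].
under eq_eseriesr do rewrite (integral_staged_cost _ _ Y_indep _ Y_bernoulli)//.
(* [h n] is the mean cost of one slot at count [n], where [1 / p (i n)] slots are expected. *)
pose h n := u n * p (i n) + v n * (1 - p (i n)).
pose a := success_count_pmf i Y.
have -> : \sum_(n < m) (u n + v n * ((1 - p (i n)) / p (i n))) =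
    \sum_(n < m) (p (i n))^-1 * h n.
  by apply: eq_bigr => n _; rewrite /h; field; exact: lt0r_neq0.
apply/cvg_lim => //; apply: cvg_EFin.
  by apply: nearW => K; rewrite sumEFin.
(* Swapping the finite sums turns the partial sums over slots into a finite combination of occupancy
   series with known limits. *)
rewrite (_ : _ \o _ = fun K => \sum_(n < m) (series (a ^~ n) K * h n)); last first.
  apply/funext => K; rewrite /= sumEFin/= exchange_big/=.
  by apply: eq_bigr => n _; rewrite seriesEnat/= mulr_suml.
apply: cvg_big => [|n _]; first exact: add_continuous.
by apply: cvgMl; exact: (success_count_pmf_series_cvg _ _ Y_indep _ Y_bernoulli).
Qed.

(** * The process expressed through the success count *)

Section remaining_size.
Context {R : realType} {N : nat} {Delta : R} {r : 'I_N -> R}.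
Context (Delta_gt0 : 0 < Delta) (r_gt0 : forall i, 0 < r i).
Context (pi : R -> 'I_N) (F : R) (F_gt0 : 0 < F).

Local Notation m := (num_transmissions Delta_gt0 r_gt0 pi F).
Local Notation F_ := (success_size Delta r pi F).

Lemma num_transmissions_gt0 : (0 < m)%N.
Proof. by rewrite /num_transmissions; case: ex_minnP => n /andP[]. Qed.

Lemma last_success_size_le : F_ m <= Delta * r (pi (F_ m)).
Proof. by rewrite /num_transmissions; case: ex_minnP => n /andP[]. Qed.

Lemma success_size_gt n : (0 < n < m)%N -> Delta * r (pi (F_ n)) < F_ n.
Proof.
rewrite /num_transmissions; case: ex_minnP => l _ l_min /andP[n_gt0 n_lt_l].
rewrite ltNge; apply/negP => Fn_le.
by have := l_min n; rewrite n_gt0 Fn_le leqNgt n_lt_l => /(_ isT).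
Qed.

(** The first size is [F]; afterwards, failure of the stopping test at index [n] says that the next
    size is positive. *)
Lemma success_size_gt0 n : (n < m)%N -> 0 < F_ n.+1.
Proof.
by case: n => // n n_lt_m; rewrite subr_gt0; exact: (success_size_gt n.+1).
Qed.

Local Notation i := (fun n => pi (F_ n.+1)).

(** Counts start at 0 and sizes at 1, whence [c.+1]. After completion the count may keep growing
    while the size stays 0; the test [c < m] absorbs this. *)
Lemma remaining_sizeE y k : remaining_size Delta r pi F y k =
  let c := success_count i y k in if (c < m)%N then F_ c.+1 else 0.
Proof.
elim: k => [|k /= ->]; first by rewrite /= num_transmissions_gt0.
set c := success_count _ _ k; case: ltnP => [c_lt_m|m_le_c]; last first.
  by rewrite ltxx/= ltnNge (leq_trans m_le_c (leq_addr _ _)).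
rewrite success_size_gt0//=; case: (y _ k); last by rewrite addn0 c_lt_m.
(* Below [m] the next size is positive and [Num.max] does not truncate; when the count reaches [m],
   the stopping inequality makes it return 0. *)
rewrite addn1; case: ltnP => [cS_lt_m|m_le_cS].
  by apply/max_idPr/ltW; exact: (success_size_gt0 c.+1).
have cS : c.+1 = m by apply/eqP; rewrite eqn_leq c_lt_m.
by apply/max_idPl; rewrite subr_le0 cS last_success_size_le.
Qed.

Lemma slot_timeE y k : slot_time Delta r pi F y k =
  staged_cost i m (fun n => Num.min Delta (F_ n.+1 / r (i n))) (fun=> Delta) y k.
Proof.
rewrite /slot_time /staged_cost remaining_sizeE/=; case: ltnP => c_lt_m.
  by rewrite success_size_gt0.
by rewrite ltxx.
Qed.

(** Before the last success the file outlasts the slot. *)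
Lemma slot_success_time n : (0 < n < m)%N ->
  Num.min Delta (F_ n / r (pi (F_ n))) = Delta.
Proof.
by move=> /success_size_gt Fn_gt; apply/min_idPl; rewrite ler_pdivlMr// ltW.
Qed.

Lemma last_success_time :
  Num.min Delta (F_ m / r (pi (F_ m))) = F_ m / r (pi (F_ m)).
Proof. by apply/min_idPr; rewrite ler_pdivrMr// last_success_size_le. Qed.

End remaining_size.

(** * The expected transfer time *)

Theorem mainTheorem4 (R : realType) (d : measure_display)
    (Omega : measurableType d) (P : probability Omega R)
    (N : nat) (Delta : R) (r p : 'I_N -> R)
    (Y : 'I_N -> nat -> {RV P >-> bool})
    (Delta_gt0 : 0 < Delta)
    (r_gt0 : forall i, 0 < r i)
    (p_gt0_le1 : forall i, 0 < p i <= 1)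
    (Y_bernoulli : forall i k, P [set w | Y i k w = true] = (p i)%:E)
    (Y_independent :
       mutually_independent (fun ik : 'I_N * nat => Y ik.1 ik.2))
    (F : R) (F_gt0 : 0 < F) (pi : R -> 'I_N) :
  let m := num_transmissions Delta_gt0 r_gt0 pi F in
  let F_ := success_size Delta r pi F in
  (\int[P]_w transfer_time Delta r pi F (fun i k => Y i k w))%E =
  (Delta * (\sum_(1 <= n < m) 1 / p (pi (F_ n)))
   + Delta * ((1 - p (pi (F_ m))) / p (pi (F_ m)))
   + F_ m / r (pi (F_ m)))%:E.
Proof.
move=> m F_.
have p_gt0 i : 0 < p i by have /andP[] := p_gt0_le1 i.
pose t n := Num.min Delta (F_ n / r (pi (F_ n))).
transitivity (\int[P]_w \sum_(0 <= k <oo) (staged_cost (fun n => pi (F_ n.+1)) m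
    (fun n => t n.+1) (fun=> Delta) (fun j l => Y j l w) k)%:E)%E.
  apply: eq_integral => w _; apply: eq_eseriesr => k _.
  by rewrite (slot_timeE Delta_gt0 r_gt0).
rewrite (integral_staged_cost_series _ _ p)//; last 2 first.
- move=> n n_lt_m; rewrite le_min ltW//= divr_ge0//; last exact: ltW.
  by apply/ltW; exact: success_size_gt0 F_gt0 _ n_lt_m.
- by move=> n _; exact: ltW.
congr EFin.
have m_gt0 : (0 < m)%N := num_transmissions_gt0 _ _ _ _.
(* Stages are numbered from 0 and transmissions from 1; after reindexing, the term of the final
   transmission [m] is split off. *)
rewrite -(big_mkord xpredT
  (fun n => t n.+1 + Delta * ((1 - p (pi (F_ n.+1))) / p (pi (F_ n.+1))))).
rewrite -(big_add1 _ _ 0 m.+1 xpredT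
  (fun n => t n + Delta * ((1 - p (pi (F_ n))) / p (pi (F_ n))))).
rewrite big_nat_recr//= -addrA [t m + _]addrC /t last_success_time.
congr (_ + _); rewrite mulr_sumr; apply: eq_big_nat => n n_m.
rewrite slot_success_time//.
(* With a full-slot success, [Delta + Delta * ((1 - p) / p)] collapses to [Delta / p]. *)
by field; exact: lt0r_neq0.
Qed.
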